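(* Fix a prompt $s_q$, and let $t_+$ and $t_-$ be single-token sequences such that $f_R(s_+)>f_R(s_-)$ for $s_+=s_q\circ t_+$ and $s_-=s_q\circ t_-$. Assume that the large language models $m$ and $m'$ respond to $s_q$ with $t_+$ with probability $p_m$ and $p_{m'}$, respectively, and with $t_-$ with probability $1-p_m$ and $1-p_{m'}$, respectively, and that the sampling mechanism defined by $f_T$ and $P_U$ satisfies counterfactual stability. Assume (without loss of generality) that $p_{m'}>p_m$. Then, under coupled autoregressive generation, $$\mathbb{E}_{\mathbf{U}\sim P_{\mathbf{U}}}\big[\mathbf{1}\{R_m(\mathbf{U},s_q)>R_{m'}(\mathbf{U},s_q)\}\big]=0,\qquad \mathbb{E}_{\mathbf{U}\sim P_{\mathbf{U}}}\big[\mathbf{1}\{R_m(\mathbf{U},s_q)<R_{m'}(\mathbf{U},s_q)\}\big]=p_{m'}-p_m.$$ Conversely, under independent autoregressive generation, i.e., with $\mathbf{U},\mathbf{U}'\sim P_{\mathbf{U}}$ independent, $$\mathbb{E}_{\mathbf{U},\mathbf{U}'\sim P_{\mathbf{U}}}\big[\mathbf{1}\{R_m(\mathbf{U},s_q)>R_{m'}(\mathbf{U}',s_q)\}\big]=p_m(1-p_{m'}),$$ $$\mathbb{E}_{\mathbf{U},\mathbf{U}'\sim P_{\mathbf{U}}}\big[\mathbf{1}\{R_m(\mathbf{U},s_q)<R_{m'}(\mathbf{U}',s_q)\}\big]=p_{m'}(1-p_m).$$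
   Context: $V$ is a finite vocabulary of tokens; $\circ$ denotes concatenation. The noise sequence is $\mathbf{U}=(U_1,\dots,U_K)$ with i.i.d. entries $U_i\sim P_U$; its law is $P_{\mathbf{U}}$. A model $m$ maps a sequence $s$ to a next-token distribution $f_D(s,m)\in\Delta(V)$. The sampling mechanism is a function $f_T$ together with $P_U$ such that, for $U\sim P_U$, the token $f_T(d,U)$ has distribution $d$ for every $d\in\Delta(V)$. For models that only output single-token sequences, the response to prompt $s_q$ under noise $\mathbf{u}$ is the single token $f_T(f_D(s_q,m),u_1)$, so the probability that $m$ responds $t$ is $[f_D(s_q,m)]_t$. The (deterministic, real-valued) score is $R_m(\mathbf{u},s_q)=f_R\big(s_q\circ f_T(f_D(s_q,m),u_1)\big)$, where $f_R$ is a given real-valued function on sequences (a higher value means the output is preferred by the user). Coupled generation means both models use the same noise $\mathbf{U}$; independent generation means they use independent noises $\mathbf{U},\mathbf{U}'$. Counterfactual stability: for any two models, any next-token distributions $d$ (under the first model) and $d'$ (under the second model) at the same generation step, and any tokens $a\neq b$ in $V$ with $d(a),d(b)>0$: if $\frac{d'(a)}{d(a)}\ge\frac{d'(b)}{d(b)}$, then $P[f_T(d',U)=b \mid f_T(d,U)=a]=0$ for $U\sim P_U$ (the same noise value is used for $d$ and $d'$). *)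

(* Defs.v *)
From HB Require Import structures.
From mathcomp Require Export all_boot all_order all_algebra.
From mathcomp Require Export all_classical all_reals all_analysis.

Set Implicit Arguments.
Unset Strict Implicit.
Unset Printing Implicit Defensive.

Import Order.TTheory GRing.Theory Num.Theory.
Local Open Scope classical_set_scope.
Local Open Scope ring_scope.

(* The simplex Delta(V); the side condition is a boolean, so a distribution is
   determined by its values. *)
Record dist (R : realType) (V : finType) := Dist {
  prob_of :> {ffun V -> R};
  _ : [forall t, 0 <= prob_of t] && (\sum_t prob_of t == 1)
}.

(* Product rule on boxes. Taking [A i = setT] for all but one or some of the
   indices gives the marginals and the independence of every subfamily; the
   rule determines PUs. *)
Definition iid_law (R : realType) (dT : measure_display) (T : measurableType dT)
    (K : nat) (PU : probability T R) (PUs : probability (K.-tuple T) R) : Prop :=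
  forall A : 'I_K -> set T, (forall i, measurable (A i)) ->
    PUs [set u | forall i, A i (tnth u i)] = (\prod_(i < K) PU (A i))%E.

Section Generation.
Context (R : realType) (V : finType) (dT : measure_display)
  (T : measurableType dT) (M : Type).
Variables (fD : seq V -> M -> dist R V) (fT : dist R V -> T -> V).

Definition sampling_mechanism (PU : probability T R) : Prop :=
  forall (d : dist R V) (t : V),
    measurable [set u | fT d u = t] /\ PU [set u | fT d u = t] = (d t)%:E.

(* [cond_prob P A B] is P(A | B); only used when P(B) > 0. *)
Definition cond_prob (P : probability T R) (A B : set T) : R :=
  fine (P (A `&` B)) / fine (P B).

(* Distributions at the same generation step come from a common prompt s
   extended by two generated prefixes r, r' of equal length. *)
Definition counterfactual_stability (PU : probability T R) : Prop :=
  forall (m m' : M) (s r r' : seq V), size r = size r' ->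
  let d := fD (s ++ r) m in
  let d' := fD (s ++ r') m' in
  forall a b : V, a <> b -> 0 < d a -> 0 < d b ->
    d' a / d a >= d' b / d b ->
    cond_prob PU [set u | fT d' u = b] [set u | fT d u = a] = 0.

(* The noise has K.+1 >= 1 entries; [thead u] is its first entry u_1. *)
Definition response (K : nat) (m : M) (u : K.+1.-tuple T) (sq : seq V) : V :=
  fT (fD sq m) (thead u).

Definition score (fR : seq V -> R) (K : nat) (m : M) (u : K.+1.-tuple T)
    (sq : seq V) : R :=
  fR (sq ++ [:: response m u sq]).

End Generation.

(* Main.v *)
(* Both responses lie almost surely in {t+, t-}, so up to null sets the events
   R_m > R_m' and R_m < R_m' are the joint events (t+, t-) and (t-, t+).
   Under coupling, the likelihood ratio p_m' / p_m of t+ exceeds the ratio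
   (1 - p_m') / (1 - p_m) of t-, so counterfactual stability makes (t+, t-) a
   null event, and the two marginals then force (t-, t+) to have probability
   p_m' - p_m. Under independence the joint events are rectangles. *)

Require Import Defs.

Set Implicit Arguments.
Unset Strict Implicit.
Unset Printing Implicit Defensive.

Import Order.TTheory GRing.Theory Num.Theory.
Local Open Scope classical_set_scope.
Local Open Scope ring_scope.

(** [F] carries no sigma-algebra, so measurability of [X] is expressed through its fibres; every
    event about [X] is a finite union of them. *)
Lemma measurable_finite_valued d (W : measurableType d) (F : finType)
    (X : W -> F) (Q : F -> Prop) :
  (forall t, measurable [set w | X w = t]) -> measurable [set w | Q (X w)].
Proof.
move=> mX.
have -> : [set w | Q (X w)] = \bigcup_(t in [set t | Q t]) [set w | X w = t].
  by apply/seteqP; split => [w Qw|w [t /= Qt ->]//]; exists (X w).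
by apply: fin_bigcup_measurable => //; exact: finite_finset.
Qed.

(** * Pairs of variables concentrated on two points *)

Section TwoPoint.
Context (R : realType) (V : finType) d (W : measurableType d)
  (P : probability W R).

(** The two fibres are disjoint and their masses already add up to 1. *)
Lemma two_point_law_null (X : W -> V) (a b : V) (p : R) : a <> b ->
  (forall t, measurable [set w | X w = t]) ->
  P [set w | X w = a] = p%:E -> P [set w | X w = b] = (1 - p)%:E ->
  P [set w | X w <> a /\ X w <> b] = 0.
Proof.
move=> ab mX Pa Pb.
have -> : [set w | X w <> a /\ X w <> b] =
    ~` ([set w | X w = a] `|` [set w | X w = b]).
  by rewrite setCU; apply/seteqP; split.
rewrite probability_setC; last exact: measurableU.
rewrite measureU //; last first.
  by apply/seteqP; split => // w [/= -> /ab].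
rewrite [X in (_ - (X + _))%E]Pa [X in (_ - (_ + X))%E]Pb.
by rewrite -EFinD (addrC p) subrK subrr.
Qed.

Variables (X Y : W -> V) (a b : V) (p q : R).
Hypotheses (ab : a <> b)
  (mX : forall t, measurable [set w | X w = t])
  (mY : forall t, measurable [set w | Y w = t])
  (PXa : P [set w | X w = a] = p%:E) (PXb : P [set w | X w = b] = (1 - p)%:E)
  (PYa : P [set w | Y w = a] = q%:E) (PYb : P [set w | Y w = b] = (1 - q)%:E).

Lemma measurable_pair_valued (Q : V -> V -> Prop) :
  measurable [set w | Q (X w) (Y w)].
Proof.
apply: (@measurable_finite_valued _ _ _ (fun w => (X w, Y w))
  (fun t => Q t.1 t.2)) => -[s t].
have -> : [set w | (X w, Y w) = (s, t)] =
    [set w | X w = s] `&` [set w | Y w = t].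
  by apply/seteqP; split => [w [<- <-]//|w [/= -> ->]].
exact: measurableI.
Qed.

(** Both events become the same set once the null set [N], where [X] or [Y] leaves the two points,
    is added to each. Later case analyses thus reduce to four value pairs. *)
Lemma probability_eq_on_two_points (Q Q' : V -> V -> Prop) :
  (forall s t, s = a \/ s = b -> t = a \/ t = b -> Q s t <-> Q' s t) ->
  P [set w | Q (X w) (Y w)] = P [set w | Q' (X w) (Y w)].
Proof.
move=> QQ'.
pose N := [set w | X w <> a /\ X w <> b] `|` [set w | Y w <> a /\ Y w <> b].
have mN : measurable N.
  by apply: measurableU; apply: (@measurable_finite_valued _ _ _ _
    (fun t => t <> a /\ t <> b)).
have N0 : P N = 0.
  rewrite /N measureU0.
  - exact: (two_point_law_null ab mX PXa PXb).
  - exact: (@measurable_finite_valued _ _ _ X (fun t => t <> a /\ t <> b)).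
  - exact: (@measurable_finite_valued _ _ _ Y (fun t => t <> a /\ t <> b)).
  - exact: (two_point_law_null ab mY PYa PYb).
rewrite -(measureU0 (measurable_pair_valued Q) mN N0).
rewrite -(measureU0 (measurable_pair_valued Q') mN N0).
congr (P _); apply/seteqP; split => w -[Qw|Nw]; try by right.
- have [Nw|/not_orP[/= nX nY]] := pselect (N w); first by right.
  left; apply/QQ' => //.
  + by apply: contrapT => /not_orP.
  + by apply: contrapT => /not_orP.
- have [Nw|/not_orP[/= nX nY]] := pselect (N w); first by right.
  left; apply/QQ' => //.
  + by apply: contrapT => /not_orP.
  + by apply: contrapT => /not_orP.
Qed.

(** The diagonal pairs tie under [g], and of the other two only (a, b) has the required order. *)
Lemma expectation_two_point_gt (g : V -> R) : g b < g a ->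
  ('E_P[\1_[set w | (g (X w) > g (Y w))%R]] =
   P [set w | X w = a /\ Y w = b])%E.
Proof.
move=> gba; rewrite expectation_indic; last first.
  exact: (measurable_pair_valued (fun s t => g s > g t)).
apply: (probability_eq_on_two_points (Q := fun s t => g s > g t)
  (Q' := fun s t => s = a /\ t = b)) => s t [->|->] [->|->]; split=> //.
- by rewrite ltxx.
- by case=> _ /ab.
- by rewrite ltNge (ltW gba).
- by case=> _ /ab.
- by rewrite ltxx.
- by case=> /esym/ab.
Qed.

Lemma expectation_two_point_lt (g : V -> R) : g b < g a ->
  ('E_P[\1_[set w | (g (X w) < g (Y w))%R]] =
   P [set w | X w = b /\ Y w = a])%E.
Proof.
move=> gba; rewrite expectation_indic; last first.
  exact: (measurable_pair_valued (fun s t => g s < g t)).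
apply: (probability_eq_on_two_points (Q := fun s t => g s < g t)
  (Q' := fun s t => s = b /\ t = a)) => s t [->|->] [->|->]; split=> //.
- by rewrite ltxx.
- by case=> /ab.
- by rewrite ltNge (ltW gba).
- by case=> /ab.
- by rewrite ltxx.
- by case=> _ /esym/ab.
Qed.

(** Up to null sets, [X = a] splits into (a, b) and (a, a), and [Y = a] into (b, a) and (a, a). As
    (a, b) is null, (a, a) has mass p, which leaves q - p for (b, a). *)
Lemma two_point_coupling : P [set w | X w = a /\ Y w = b] = 0 ->
  P [set w | X w = b /\ Y w = a] = (q - p)%:E.
Proof.
move=> Pab.
(* Additivity modulo null sets: [B] and [C] exclude each other everywhere, but [A] has to be their
   union only on the four pairs. *)
have split (A B C : V -> V -> Prop) :
    (forall s t, B s t -> C s t -> False) ->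
    (forall s t, s = a \/ s = b -> t = a \/ t = b -> A s t <-> B s t \/ C s t) ->
    (P [set w | A (X w) (Y w)] = P [set w | B (X w) (Y w)] +
       P [set w | C (X w) (Y w)])%E.
  move=> BC ABC.
  rewrite (probability_eq_on_two_points (Q' := fun s t => B s t \/ C s t)) //.
  rewrite -measureU; [by []|exact: measurable_pair_valued..|].
  by apply/seteqP; split => // w [] /BC /[apply].
have Xsplit := split (fun s _ => s = a) (fun s t => s = a /\ t = b)
  (fun s t => s = a /\ t = a).
have Ysplit := split (fun _ t => t = a) (fun s t => s = b /\ t = a)
  (fun s t => s = a /\ t = a).
have {}Xsplit : (P [set w | X w = a /\ Y w = a] = p%:E)%E.
  rewrite -PXa Xsplit; first by rewrite [X in (X + _)%E]Pab add0e.
  - by move=> s t [_ ->] [_ /esym/ab].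
  - by move=> s t _ [] ->; tauto.
have {}Ysplit : (q%:E = P [set w | X w = b /\ Y w = a] + p%:E)%E.
  rewrite -PYa -Xsplit Ysplit //.
  - by move=> s t [-> _] [/esym/ab].
  - by move=> s t [] -> _; tauto.
by rewrite EFinB Ysplit addeK.
Qed.

End TwoPoint.

(** * Rectangles and marginals of a product of probabilities *)

Section Product.
Context d1 d2 (W1 : measurableType d1) (W2 : measurableType d2) (R : realType).
Variables (P1 : probability W1 R) (P2 : probability W2 R).

Lemma measurable_preimage_fst (A : set W1) : measurable A ->
  measurable [set w : W1 * W2 | A w.1].
Proof.
move=> mA; rewrite (_ : mkset _ = A `*` setT); first exact: measurableX.
by apply/seteqP; split => // w [].
Qed.

Lemma measurable_preimage_snd (B : set W2) : measurable B ->
  measurable [set w : W1 * W2 | B w.2].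
Proof.
move=> mB; rewrite (_ : mkset _ = setT `*` B); first exact: measurableX.
by apply/seteqP; split => // w [].
Qed.

Lemma product_measure_rect (A : set W1) (B : set W2) :
  measurable A -> measurable B ->
  (P1 \x P2)%E [set w | A w.1 /\ B w.2] = (P1 A * P2 B)%E.
Proof. by move=> mA mB; rewrite -product_measure1E. Qed.

Lemma product_probability_fst (A : set W1) : measurable A ->
  (P1 \x P2)%E [set w | A w.1] = P1 A.
Proof.
move=> mA; rewrite -[RHS]mule1 -(probability_setT P2) -product_measure_rect//.
by congr (_ _); apply/seteqP; split => // w [].
Qed.

Lemma product_probability_snd (B : set W2) : measurable B ->
  (P1 \x P2)%E [set w | B w.2] = P2 B.
Proof.
move=> mB; rewrite -[RHS]mul1e -(probability_setT P1) -product_measure_rect//.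
by congr (_ _); apply/seteqP; split => // w [].
Qed.

End Product.

(** * The first entry of i.i.d. noise *)

Section Iid.
Context (R : realType) (dT : measure_display) (T : measurableType dT)
  (PU : probability T R) (K : nat) (PUs : probability (K.+1.-tuple T) R).

(** A response reads only the first noise entry, so this carries events between [PUs] and [PU], the
    law in which sampling and stability are stated. The box has [S] at index 0 and full sides of
    mass 1 elsewhere. *)
Lemma iid_law_thead (S : set T) : iid_law PU PUs -> measurable S ->
  PUs [set u | S (thead u)] = PU S.
Proof.
move=> iid mS.
have := iid (fun i => if i == ord0 then S else setT).
rewrite big_ord_recl /= big1 ?mule1; last by move=> i _; rewrite probability_setT.
move=> <-; last by move=> i; case: ifP.
congr (PUs _); apply/seteqP; split => [u Su i|u /(_ ord0)//].
by case: eqP => [->|].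
Qed.

End Iid.

(** * From conditional to joint null events *)

Section CounterfactualStability.
Context (R : realType) (V : finType) (M : Type) (dT : measure_display)
  (T : measurableType dT) (PU : probability T R)
  (fD : seq V -> M -> dist R V) (fT : dist R V -> T -> V).

(* The likelihood ratios are compared after cross-multiplication, so that the
   lemma also covers d(a) = 0, where the ratio d'(a) / d(a) is the junk value 0. *)
Lemma stable_coupling_null (m m' : M) (s : seq V) (a b : V) :
  sampling_mechanism fT PU -> counterfactual_stability fD fT PU -> a <> b ->
  0 < fD s m b -> fD s m' b * fD s m a <= fD s m' a * fD s m b ->
  PU [set u | fT (fD s m) u = a /\ fT (fD s m') u = b] = 0.
Proof.
move=> smp cs ab db_gt0 ratio.
have [mA PA] := smp (fD s m) a; have [mB _] := smp (fD s m') b.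
have mAB := measurableI _ _ mA mB.
have le_AB : (PU ([set u | fT (fD s m) u = a] `&` [set u | fT (fD s m') u = b])
    <= (fD s m a)%:E)%E.
  by rewrite -PA; apply: le_measure; rewrite ?inE//; exact: subIsetl.
(* If d(a) = 0, the joint event lies inside a null event and stability is not invoked. *)
have [da0|da_le0] := ltP 0 (fD s m a); last first.
  by apply/eqP; rewrite eq_le measure_ge0 andbT (le_trans le_AB)// lee_fin.
have {}ratio : fD s m' b / fD s m b <= fD s m' a / fD s m a.
  by rewrite ler_pdivrMr// mulrAC ler_pdivlMr.
(* Empty prefixes: this is the first generation step. *)
have := cs m m' s [::] [::] erefl a b ab; rewrite !cats0 => /(_ da0 db_gt0 ratio).
rewrite /cond_prob PA /= => /eqP; rewrite mulf_eq0 invr_eq0 (gt_eqF da0) orbF.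
rewrite setIC => /eqP num0.
(* Finiteness matters here, since [fine] also sends infinite values to 0. *)
by rewrite -[LHS]fineK ?num0//; exact: fin_num_measure.
Qed.

End CounterfactualStability.

(** * Win probabilities under coupled and independent noise *)

Theorem proposition4 (R : realType) (V : finType) (M : Type)
  (dT : measure_display) (T : measurableType dT) (PU : probability T R)
  (K : nat) (PUs : probability (K.+1.-tuple T) R)
  (fD : seq V -> M -> dist R V) (fT : dist R V -> T -> V) (fR : seq V -> R)
  (sq : seq V) (tp tm : V) (m m' : M) (pm pm' : R) :
  iid_law PU PUs ->
  sampling_mechanism fT PU ->
  fR (sq ++ [:: tp]) > fR (sq ++ [:: tm]) ->
  PUs [set u | response fD fT m u sq = tp] = pm%:E ->
  PUs [set u | response fD fT m u sq = tm] = (1 - pm)%:E ->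
  PUs [set u | response fD fT m' u sq = tp] = pm'%:E ->
  PUs [set u | response fD fT m' u sq = tm] = (1 - pm')%:E ->
  counterfactual_stability fD fT PU ->
  pm' > pm ->
  (('E_PUs[\1_[set u | (score fD fT fR m u sq > score fD fT fR m' u sq)%R]]
      = 0)%E /\
   ('E_PUs[\1_[set u | (score fD fT fR m u sq < score fD fT fR m' u sq)%R]]
      = (pm' - pm)%:E)%E) /\
  (('E_(PUs \x PUs)[\1_[set w | (score fD fT fR m w.1 sq
                                  > score fD fT fR m' w.2 sq)%R]]
      = (pm * (1 - pm'))%:E)%E /\
   ('E_(PUs \x PUs)[\1_[set w | (score fD fT fR m w.1 sq
                                  < score fD fT fR m' w.2 sq)%R]]
      = (pm' * (1 - pm))%:E)%E).
Proof.
move=> iid smp fRlt Xp Xm Yp Ym cs pmlt.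
have tptm : tp <> tm by move=> e; rewrite e ltxx in fRlt.
have mresp m0 t : measurable [set u | response fD fT (K := K) m0 u sq = t].
  have [mS _] := smp (fD sq m0) t.
  rewrite -[X in measurable X]setTI.
  exact: (measurable_tnth ord0 measurableT mS).
have respE m0 t :
    PUs [set u | response fD fT m0 u sq = t] = (fD sq m0 t)%:E.
  by have [mS <-] := smp (fD sq m0) t; rewrite -(iid_law_thead iid mS).
have dist_val m0 t p :
    PUs [set u | response fD fT m0 u sq = t] = p%:E -> fD sq m0 t = p.
  by rewrite respE => -[].
have pm'_le1 : pm' <= 1.
  by rewrite -lee_fin -Yp; exact: probability_le1.
(* This is the positivity of d(t-) that [stable_coupling_null] asks for; [pm] itself may be 0. *)
have omp_gt0 : 0 < 1 - pm by rewrite subr_gt0 (lt_le_trans pmlt).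
have coupled0 : PUs [set u | response fD fT m u sq = tp /\
    response fD fT m' u sq = tm] = 0.
  have [mA PA] := smp (fD sq m) tp; have [mB _] := smp (fD sq m') tm.
  rewrite -[RHS](_ : PU ([set u | fT (fD sq m) u = tp] `&`
      [set u | fT (fD sq m') u = tm]) = 0).
    exact: (iid_law_thead iid (measurableI _ _ mA mB)).
  apply: (stable_coupling_null smp cs tptm).
    by rewrite (dist_val _ _ _ Xm).
  (* The ratio condition reads (1 - pm') pm <= pm' (1 - pm); cancelling the common product leaves pm
     <= pm'. *)
  rewrite (dist_val _ _ _ Xp) (dist_val _ _ _ Xm) (dist_val _ _ _ Yp).
  rewrite (dist_val _ _ _ Ym) mulrBl mulrBr mul1r mulr1 lerD2r.
  exact: ltW.
(* Scores are [g] of the responses, which puts both comparisons in the form of the two-point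
   lemmas. *)
pose g t := fR (sq ++ [:: t]).
have g_lt : g tm < g tp := fRlt.
split; [split|].
- rewrite -[RHS]coupled0.
  exact: (expectation_two_point_gt tptm _ _ Xp Xm Yp Ym g_lt).
- rewrite -(two_point_coupling tptm _ _ Xp Xm Yp Ym)//.
  exact: (expectation_two_point_lt tptm _ _ Xp Xm Yp Ym g_lt).
(* On the product space each response reads its own coordinate and keeps its law, so the same
   two-point lemmas apply. *)
have mX t : measurable [set w : K.+1.-tuple T * K.+1.-tuple T |
    response fD fT m w.1 sq = t] := measurable_preimage_fst (mresp m t).
have mY t : measurable [set w : K.+1.-tuple T * K.+1.-tuple T |
    response fD fT m' w.2 sq = t] := measurable_preimage_snd (mresp m' t).
have Xp2 := etrans (product_probability_fst PUs PUs (mresp m tp)) Xp.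
have Xm2 := etrans (product_probability_fst PUs PUs (mresp m tm)) Xm.
have Yp2 := etrans (product_probability_snd PUs PUs (mresp m' tp)) Yp.
have Ym2 := etrans (product_probability_snd PUs PUs (mresp m' tm)) Ym.
split.
- rewrite [LHS](expectation_two_point_gt (P := (PUs \x PUs)%E)
    tptm mX mY Xp2 Xm2 Yp2 Ym2 g_lt).
  rewrite [LHS](product_measure_rect PUs PUs (mresp m tp) (mresp m' tm)).
  by rewrite Xp Ym.
- rewrite [LHS](expectation_two_point_lt (P := (PUs \x PUs)%E)
    tptm mX mY Xp2 Xm2 Yp2 Ym2 g_lt).
  rewrite [LHS](product_measure_rect PUs PUs (mresp m tm) (mresp m' tp)).
  by rewrite Xm Yp muleC.
Qed.
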